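(* Let $f:\Gamma\to\mathbb{R}$ be a smooth symmetric function on the cone $\Gamma\subsetneq\mathbb{R}^n$. Assume that $f$ is concave in $\Gamma$, that $\lim_{t\to+\infty}f(t\lambda)>-\infty$ for every $\lambda\in\Gamma_n$, and that $\sum_{i=1}^n f_i>0$ in $\Gamma$. Then $$f_i(\lambda)\le\frac{1}{\varrho_{\Gamma_{\mathcal{G}}^{f}}}\sum_{j=1}^n f_j(\lambda)\quad\text{for all }\lambda\in\Gamma,\ 1\le i\le n.$$ Suppose in addition that for some $\sigma\in(\sup_{\partial\Gamma}f,\ \sup_\Gamma f)$ and $K_0\in\mathbb{R}$, $$\sum_{i=1}^n f_i(\lambda)\lambda_i\ge-K_0\sum_{i=1}^n f_i(\lambda)\quad\text{for all }\lambda\in\partial\Gamma^\sigma .$$ Then, for the same $\sigma$ and $K_0$, $$\sum_{i=1}^n f_i(\lambda)\lambda_i\ge-K_0\sum_{i=1}^n f_i(\lambda)\quad\text{for all }\lambda\in\overline{\Gamma}^{\,\sigma}.$$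
   Context: $\Gamma\subsetneq\mathbb{R}^n$ is an open convex cone with vertex at the origin, invariant under permutations of coordinates, with nonempty boundary $\partial\Gamma$, and containing $\Gamma_n=\{\lambda\in\mathbb{R}^n:\text{each }\lambda_i>0\}$. Write $f_i=\partial f/\partial\lambda_i$. $\sup_{\partial\Gamma}f=\sup_{\lambda^0\in\partial\Gamma}\limsup_{\lambda\to\lambda^0}f(\lambda)$ (with $\lambda\in\Gamma$). For $\sigma\in(\sup_{\partial\Gamma}f,\sup_\Gamma f)$: $\Gamma^\sigma=\{\lambda\in\Gamma:f(\lambda)>\sigma\}$, $\partial\Gamma^\sigma=\{\lambda\in\Gamma:f(\lambda)=\sigma\}$, $\overline{\Gamma}^{\,\sigma}=\Gamma^\sigma\cup\partial\Gamma^\sigma$. $\Gamma_{\mathcal{G}}^{f}=\{\lambda\in\Gamma:\lim_{t\to+\infty}f(t\lambda)>-\infty\}$, and the constant $\varrho_{\Gamma_{\mathcal{G}}^{f}}$ is determined by $(1,\dots,1,1-\varrho_{\Gamma_{\mathcal{G}}^{f}})\in\partial\Gamma_{\mathcal{G}}^{f}$. *)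

(* Defs.v *)
From HB Require Import structures.
From mathcomp Require Import all_boot all_order all_algebra all_fingroup.
From mathcomp Require Import all_classical all_reals all_analysis.

Set Implicit Arguments.
Unset Strict Implicit.
Unset Printing Implicit Defensive.

Import Order.TTheory GRing.Theory Num.Theory.
Import numFieldNormedType.Exports.

Local Open Scope classical_set_scope.
Local Open Scope ring_scope.

(* A function on an open set [G] of R^n is represented by a total function     *)
(* ['rV[R]_n -> R]; no notion below depends on its values outside [G].         *)

Section Cones.
Context {R : realType} {n : nat}.
Implicit Types G A : set 'rV[R]_n.

Definition boundary A : set 'rV[R]_n := closure A `\` interior A.

Definition is_cone G := forall (t : R) x, 0 < t -> G x -> G (t *: x).

Definition symmetric_set G := forall (s : 'S_n) x, G x -> G (col_perm s x).

Definition positive_cone : set 'rV[R]_n := [set x | forall i, 0 < x 0 i].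

End Cones.

Section Functions.
Context {R : realType} {n : nat}.
Implicit Types (G : set 'rV[R]_n) (f : 'rV[R]_n -> R).

Definition symmetric_fun G f :=
  forall (s : 'S_n) x, G x -> f (col_perm s x) = f x.

Definition concave_on G f := convex_function G (fun x => - f x).

Definition partial (i : 'I_n) f : 'rV[R]_n -> R :=
  fun x => 'D_(delta_mx 0 i) f x.

Definition iter_partial (s : seq 'I_n) f : 'rV[R]_n -> R := foldr partial f s.

(* Class C^oo on the open set [G]: partial derivatives of all orders exist     *)
(* and are continuous at every point of [G].                                   *)
Definition smooth_on G f :=
  forall (s : seq 'I_n) x, G x ->
    {for x, continuous (iter_partial s f)} /\
    forall i : 'I_n, derivable (iter_partial s f) x (delta_mx 0 i).

(* The limit is taken in the extended reals, so it may be [+oo].               *)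
Definition ray_limit_gt_ninfty f (x : 'rV[R]_n) :=
  exists2 l : \bar R, (f (t *: x))%:E @[t --> +oo%R] --> l & (-oo < l)%E.

Definition sup_on G f : \bar R := ereal_sup [set (f x)%:E | x in G].

Definition sup_boundary G f : \bar R :=
  ereal_sup [set limf_esup (fun x => (f x)%:E) (within G (nbhs x0))
            | x0 in boundary G].

Definition superlevel G f (sigma : R) : set 'rV[R]_n :=
  [set x | G x /\ sigma < f x].

Definition level G f (sigma : R) : set 'rV[R]_n :=
  [set x | G x /\ f x = sigma].

Definition closed_superlevel G f (sigma : R) : set 'rV[R]_n :=
  superlevel G f sigma `|` level G f sigma.

Definition cone_of G f : set 'rV[R]_n :=
  [set x | G x /\ ray_limit_gt_ninfty f x].

End Functions.

(* [n.+1] coordinates, so that the last one exists.                            *)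
Definition ones_but_last {R : realType} {n : nat} (a : R) : 'rV[R]_n.+1 :=
  \row_j (if j == ord_max then a else 1).

(* The number [r] such that (1, ..., 1, 1 - r) is a boundary point of [A].     *)
Definition cone_constant {R : realType} {n : nat} (A : set 'rV[R]_n.+1) : R :=
  get [set r : R | boundary A (ones_but_last (1 - r))].

(* Main.v *)
Require Import Defs.
From mathcomp Require Import all_boot all_order all_algebra all_fingroup.
From mathcomp Require Import all_classical all_reals all_analysis.
From mathcomp Require Import ring lra.

Set Implicit Arguments.
Unset Strict Implicit.
Unset Printing Implicit Defensive.

Import Order.TTheory GRing.Theory Num.Theory.
Import numFieldNormedType.Exports.

Local Open Scope classical_set_scope.
Local Open Scope ring_scope.

(** Both inequalities come from one fact about a concave function [f] on a
    convex open set: it lies below its tangent planes,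
      [f y <= f x + <grad f(x), y - x>],
    where the pairing is taken with the vector of partial derivatives
    ([supergradient]).

    First inequality. Let [m] be a direction along which [f (t m)] stays bounded
    below as [t] grows. The tangent plane at [x] bounds [f (t m)] above by an
    affine function of [t] with slope [<grad f(x), m>], so this slope is
    nonnegative ([ray_limit_grad_ge0]). The condition is closed in [m], hence it
    persists on the boundary of [cone_of G f], in particular at every coordinate
    permutation of [(1, ..., 1, 1 - r)], where [r] is the cone constant. Putting
    the exceptional entry in position [i] gives
    [\sum_j f_j(x) - r f_i(x) >= 0]. It remains to see that [r] exists and is
    positive ([cone_constantP]): decreasing the last entry from [1], one leaves
    the cone at the latest when the entries sum to zero, since the mean of the
    permutations of such a vector is the origin, which is not in [G]; and one
    does not leave it while all entries are positive.

    Second inequality. Put [h = x + K0 (1, ..., 1)], so that the claim at [x]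
    reads [<grad f(x), h> >= 0]. If this failed at a point with [f x > sigma],
    then [f] would drop along the ray [x + s h] below [sigma]: either by its
    tangent plane, if the ray stays in [G], or because [f] is below [sigma] in
    [G] near the boundary. So the ray meets the level set at some
    [z = x + s h] with [s > 0] ([descending_ray_meets_level]). The tangent
    plane at [z], evaluated at [x], gives [s <grad f(z), h> <= sigma - f x < 0],
    whereas [z + K0 (1, ..., 1) = (1 + s) h], so the hypothesis at [z] says
    [<grad f(z), h> >= 0]. *)

(** * Concave functions lie below their tangent planes *)

Section Concavity.
Context {R : realType} {n : nat}.
Implicit Types (G : set 'rV[R]_n) (f : 'rV[R]_n -> R) (x y h : 'rV[R]_n).

(** The value at [h] of the differential of [f] at [x], expressed through the
    partial derivatives alone. *)
Definition grad_pair f x h : R := \sum_i partial i f x * h 0 i.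

Lemma grad_pairD f x h k :
  grad_pair f x (h + k) = grad_pair f x h + grad_pair f x k.
Proof.
by rewrite /grad_pair -big_split/=; apply: eq_bigr => i _; rewrite mxE mulrDr.
Qed.

Lemma grad_pairZ f x a h : grad_pair f x (a *: h) = a * grad_pair f x h.
Proof.
by rewrite /grad_pair mulr_sumr; apply: eq_bigr => i _; rewrite mxE mulrCA.
Qed.

Lemma grad_pair_const f x a :
  grad_pair f x (const_mx a) = a * \sum_i partial i f x.
Proof.
by rewrite /grad_pair mulr_sumr; apply: eq_bigr => i _; rewrite mxE mulrC.
Qed.

Lemma convex_set_comb G x y (a : R) : convex_set G -> G x -> G y ->
  0 <= a <= 1 -> G (a *: x + (1 - a) *: y).
Proof.
move=> cG Gx Gy /andP[a0 a1].
by have := cG x y (Itv01 a0 a1); rewrite !inE; exact.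
Qed.

Lemma concave_on_comb G f x y (a : R) : concave_on G f -> G x -> G y ->
  0 <= a <= 1 -> a * f x + (1 - a) * f y <= f (a *: x + (1 - a) *: y).
Proof.
move=> cf Gx Gy /andP[a0 a1].
have := cf (Itv01 a0 a1) x y; rewrite !inE => /(_ Gx Gy).
by rewrite convRE/= !mulrN -opprD lerN2.
Qed.

(** The induction step of Jensen's inequality for equal weights. Over a general
    module it applies both to the points and to the values of the function. *)
Lemma mean_recr (V : lmodType R) m (y : 'I_m.+2 -> V)
    (a := m.+1%:R / m.+2%:R : R) :
  0 <= a <= 1 /\
  m.+2%:R^-1 *: \sum_i y i =
  a *: (m.+1%:R^-1 *: \sum_(i < m.+1) y (widen_ord (leqnSn m.+1) i)) +
  (1 - a) *: y ord_max.
Proof.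
have m2 : m.+2%:R != 0 :> R by rewrite pnatr_eq0.
have m1 : m.+1%:R != 0 :> R by rewrite pnatr_eq0.
split; first by rewrite divr_ge0//= ler_pdivrMr ?ltr0n// mul1r ler_nat leqnSn.
have -> : 1 - a = m.+2%:R^-1.
  by apply: (mulIf m2); rewrite mulVf// mulrBl divfK// mul1r -natrB// subSnn.
by rewrite big_ord_recr/= scalerDr scalerA mulrAC divff// mul1r.
Qed.

Lemma convex_set_mean G m (y : 'I_m.+1 -> 'rV[R]_n) :
  convex_set G -> (forall i, G (y i)) -> G (m.+1%:R^-1 *: \sum_i y i).
Proof.
move=> cG; elim: m y => [|m IH] y Gy; first by rewrite big_ord1 invr1 scale1r.
have [a01 ->] := mean_recr y.
by apply: convex_set_comb => //; exact: IH.
Qed.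

Lemma concave_on_mean G f m (y : 'I_m.+1 -> 'rV[R]_n) :
  convex_set G -> concave_on G f -> (forall i, G (y i)) ->
  m.+1%:R^-1 * \sum_i f (y i) <= f (m.+1%:R^-1 *: \sum_i y i).
Proof.
move=> cG cf; elim: m y => [|m IH] y Gy.
  by rewrite !big_ord1 invr1 scale1r mul1r.
have [a01 ->] := mean_recr y.
have Gy' i : G (y (widen_ord (leqnSn m.+1) i)) by [].
apply: le_trans (concave_on_comb cf (convex_set_mean cG Gy') (Gy ord_max) a01).
have fE : m.+2%:R^-1 * \sum_i f (y i) = _ :=
  (mean_recr (V := R^o) (fun i => f (y i))).2.
by rewrite fE lerD2r ler_wpM2l ?IH//; case/andP: a01.
Qed.

Lemma continuous_line x h : continuous (fun k : R => x + k *: h).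
Proof.
move=> k; apply: cvgD; first exact: cvg_cst.
by apply: cvgZr_tmp; exact: cvg_id.
Qed.

Lemma near_line G x h :
  open G -> G x -> \forall k \near (0 : R), G (x + k *: h).
Proof.
move=> oG Gx; apply: (@continuous_line x h 0).
by rewrite scale0r addr0; exact: open_nbhs_nbhs.
Qed.

Lemma partial_near f x i (e : R) : derivable f x (delta_mx 0 i) -> 0 < e ->
  \forall k \near (0 : R),
    `|f (x + k *: delta_mx 0 i) - f x - k * partial i f x| <= e * `|k|.
Proof.
move=> /derivable_nbhs /eqaddoP df e0; have := df e e0.
apply: filterS => k /=; rewrite /cst /=.
rewrite -[(_ - _) k]/(f (k *: delta_mx 0 i + x) - (f x + k * partial i f x)).
by rewrite opprD addrA [_ + x]addrC.
Qed.

End Concavity.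

(** Concavity reduces the inequality to the behaviour of [f] on the coordinate
    axes through [x]. With [h = y - x] and [N] the dimension, [x] lies between
    [y] and [x - t h], so [f y - f x <= (f x - f (x - t h)) / t]; and [x - t h]
    is the mean of the points [x - t N h_i e_i], so Jensen's inequality bounds
    [f (x - t h)] below by values of [f] that the partial derivatives control as
    [t] tends to zero. *)
Lemma supergradient (R : realType) n (G : set 'rV[R]_n.+1) f x y :
  open G -> convex_set G -> concave_on G f ->
  (forall i, derivable f x (delta_mx 0 i)) -> G x -> G y ->
  f y <= f x + grad_pair f x (y - x).
Proof.
move=> oG cG cf df Gx Gy; set h := y - x.
pose N : R := n.+1%:R.
have N0 : 0 < N by rewrite ltr0n.
apply/ler_addgt0Pr => e e0.
pose S := 1 + \sum_i `|h 0 i|.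
have S0 : 0 < S by rewrite ltr_pwDl// sumr_ge0.
have eS0 : 0 < e / S by rewrite divr_gt0.
pose c i := - (N * h 0 i).
have cvgc i : (fun t : R => t * c i) t @[t --> 0] --> (0 : R).
  by rewrite -[X in _ --> X](mul0r (c i)); apply: cvgMr_tmp; exact: cvg_id.
(* The total error is [e / S * \sum_i |h_i| <= e]; the summand 1 in [S] only
   keeps it positive. *)
have near_axis i : \forall t \near (0 : R), G (x + (t * c i) *: delta_mx 0 i) /\
   `|f (x + (t * c i) *: delta_mx 0 i) - f x - (t * c i) * partial i f x|
     <= (e / S) * `|t * c i|.
  have near0 := @filterI _ _ (nbhs_filter _) _ _
    (near_line (delta_mx 0 i) oG Gx) (partial_near (df i) eS0).
  exact: (cvgc i _ near0).
have [d d0 dP] := (nbhs_ballP _ _).1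
  (@filter_forall _ _ _ _ (nbhs_filter _) near_axis).
have [t t0 /dP tP] : exists2 t : R, 0 < t & ball 0 d t.
  exists (d / 2); first by rewrite divr_gt0.
  rewrite /ball/= sub0r normrN gtr0_norm ?divr_gt0//.
  by rewrite ltr_pdivrMr// ltr_pMr// ltr1n.
have Gm := convex_set_mean cG (fun i => (tP i).1).
have fm := concave_on_mean cG cf (fun i => (tP i).1).
have E : n.+1%:R^-1 *: \sum_i (x + (t * c i) *: delta_mx 0 i) = x - t *: h.
  rewrite big_split/= sumr_const card_ord -[x *+ _]scaler_nat.
  rewrite scalerDr scalerA mulVf ?pnatr_eq0// scale1r.
  congr (_ + _); rewrite [in RHS](row_sum_delta h) -scaleNr !scaler_sumr.
  apply: eq_bigr => i _; rewrite !scalerA /c -/N; congr (_ *: _).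
  by field; rewrite gt_eqF.
rewrite E in Gm fm.
have t1 : 0 <= t / (1 + t) <= 1.
  have t1_gt0 : 0 < 1 + t by rewrite addr_gt0.
  by rewrite (ltW (divr_gt0 _ _))//= ler_pdivrMr// mul1r lerDr.
(* [x] is the barycentre of [y] and [x - t *: h] with weights [t] and 1. *)
have := concave_on_comb cf Gy Gm t1.
have -> : (t / (1 + t)) *: y + (1 - t / (1 + t)) *: (x - t *: h) = x.
  apply/rowP => j; rewrite !mxE; field; rewrite gt_eqF// addr_gt0//.
have t1E : 1 - t / (1 + t) = (1 + t)^-1 by field; rewrite gt_eqF// addr_gt0.
rewrite t1E [t / _]mulrC -mulrA -mulrDr ler_pdivrMl ?addr_gt0// => Hc.
have lb : f x - t * grad_pair f x h - t * e <= f (x - t *: h).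
  apply: le_trans fm; rewrite -/N ler_pdivlMl//.
  apply: (@le_trans _ _ (\sum_i (f x + t * c i * partial i f x
      - e / S * (t * N * `|h 0 i|)))); last first.
    apply: ler_sum => i _; have := (tP i).2.
    rewrite /c mulrN normrN !normrM (gtr0_norm t0) (gtr0_norm N0) mulrA.
    by rewrite ler_norml => /andP[+ _]; lra.
  rewrite big_split/= big_split/= sumr_const card_ord -[f x *+ _]mulr_natl -/N.
  rewrite sumrN -2!mulr_sumr.
  have -> : \sum_i t * c i * partial i f x = - (t * N * grad_pair f x h).
    rewrite /grad_pair mulr_sumr -sumrN; apply: eq_bigr => i _.
    by rewrite /c; ring.
  have : e / S * \sum_i `|h 0 i| <= e.
    by rewrite -mulrA ger_pMr// mulrC ler_pdivrMr// mul1r lerDr.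
  move=> /(ler_wpM2l (ltW (mulr_gt0 t0 N0))); lra.
rewrite -(ler_pM2l t0); lra.
Qed.

(** * Leaving a set along a ray *)

(** The exit time is the supremum of the times before which the ray has stayed
    in [A]; the exit point is approached from within [A] by the supremum
    property, and is not interior, as the ray would otherwise stay longer. The
    second part of the conclusion is what allows an intermediate value argument
    on the segment up to a point close to the exit. *)
Lemma exit_point (R : realType) n (A : set 'rV[R]_n) x h (s0 : R) :
  A x -> 0 <= s0 -> ~ A (x + s0 *: h) ->
  exists2 s : R, boundary A (x + s *: h) &
    forall V, nbhs (x + s *: h) V ->
      exists r : R, [/\ 0 <= r, V (x + r *: h) &
        forall q, 0 <= q <= r -> A (x + q *: h)].
Proof.
move=> Ax s0_ge0 nAs0.
pose S := [set s : R | 0 <= s /\ forall q, 0 <= q <= s -> A (x + q *: h)].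
have S0 : S 0.
  split=> // q; rewrite -eq_le => /eqP <-; by rewrite scale0r addr0.
have Sub : ubound S s0.
  move=> s [s_ge0 sA]; rewrite leNgt; apply/negP => s0s.
  by apply: nAs0; apply: sA; rewrite s0_ge0 ltW.
have hasS : has_sup S by split; [exists 0|exists s0].
have approach V : nbhs (x + sup S *: h) V -> exists d : R, [/\ 0 < d,
    forall k, `|sup S - k| < d -> V (x + k *: h) &
    exists2 s, S s & sup S - d < s].
  move=> /(@continuous_line _ _ x h (sup S)) /nbhs_ballP[d /= d0 dV].
  by exists d; split=> //; exact: sup_adherent.
have near_sup V : nbhs (x + sup S *: h) V ->
    exists r : R, [/\ 0 <= r, V (x + r *: h) &
      forall q, 0 <= q <= r -> A (x + q *: h)].
  move=> /approach[d [d0 dV [s [s_ge0 sA] ds]]]; exists s; split=> //.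
  have s_le : s <= sup S by apply: (ub_le_sup hasS.2).
  by apply: dV; rewrite ger0_norm ?subr_ge0//; lra.
exists (sup S) => //; split.
  move=> V /near_sup[r [r0 Vr Ar]]; exists (x + r *: h); split=> //.
  by apply: Ar; rewrite r0 lexx.
move=> /approach[d [d0 dA [s [s_ge0 sA] ds]]].
have : S (sup S + d / 2).
  have := ub_le_sup hasS.2 S0; split; first lra.
  move=> q /andP[q0 qd]; have [qs|sq] := leP q s.
    by apply: sA; rewrite q0.
  by apply: dA; rewrite ltr_norml; apply/andP; split; lra.
move=> /(ub_le_sup hasS.2); lra.
Qed.

(** * Consequences of the tangent plane inequality *)

Section Supergradient.
Context {R : realType} {n : nat}.
Context (G : set 'rV[R]_n.+1) (f : 'rV[R]_n.+1 -> R).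
Context (G_open : open G) (G_convex : convex_set G)
  (f_smooth : smooth_on G f) (f_concave : concave_on G f).

Lemma smooth_continuous x : G x -> {for x, continuous f}.
Proof. by move=> Gx; have [] := f_smooth [::] Gx. Qed.

Lemma smooth_supergradient x y : G x -> G y ->
  f y <= f x + grad_pair f x (y - x).
Proof.
move=> Gx Gy; apply: (supergradient G_open G_convex f_concave) => // i.
by have [_] := f_smooth [::] Gx; exact.
Qed.

(** A negative slope [<grad f(x), m>] would make the affine upper bound for
    [f (t m)], hence [f (t m)] itself, tend to minus infinity. *)
Lemma ray_limit_grad_ge0 x m : is_cone G -> G x -> cone_of G f m ->
  0 <= grad_pair f x m.
Proof.
move=> G_cone Gx [Gm [l fl l_gt]]; rewrite leNgt; apply/negP => D_lt0.
have below (M : R) : (l <= M%:E)%E.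
  apply: (cvge_to_le fl).
  (* Beyond [T] the tangent plane at [x] is below [M] along the ray. *)
  pose T := (M - f x + grad_pair f x x) / grad_pair f x m.
  near=> t.
  have t0 : 0 < t by near: t; apply: nbhs_pinfty_gt; rewrite num_real.
  have tT : T <= t by near: t; apply: nbhs_pinfty_ge; rewrite num_real.
  rewrite lee_fin.
  apply: le_trans (smooth_supergradient Gx (G_cone _ _ t0 Gm)) _.
  rewrite grad_pairD -scaleN1r !grad_pairZ.
  move: tT; rewrite /T ler_ndivrMr//; lra.
case: l fl l_gt below => [r| |] // _ _ below.
  by have := below (r - 1); rewrite lee_fin; lra.
by have := below 0.
Unshelve. all: by end_near. Qed.

(** The ray either stays in [G], where its tangent plane takes [f] below any
    bound, or approaches the boundary of [G], near which [f] is below [sigma];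
    the level [sigma] is then attained by the intermediate value theorem. *)
Lemma descending_ray_meets_level x h sigma :
  (sup_boundary G f < sigma%:E)%E ->
  G x -> sigma < f x -> grad_pair f x h < 0 ->
  exists2 s : R, 0 < s & level G f sigma (x + s *: h).
Proof.
move=> bd Gx sx D_lt0.
have [r [r0 rG fr]] : exists r : R, [/\ 0 <= r,
    forall q, 0 <= q <= r -> G (x + q *: h) & f (x + r *: h) < sigma].
  have [allG|] := pselect (forall s : R, 0 <= s -> G (x + s *: h)).
    (* The time at which the tangent plane takes the value [sigma - 1]. *)
    pose r := (sigma - f x - 1) / grad_pair f x h.
    have r0 : 0 <= r by rewrite /r ler_ndivlMr// mul0r; lra.
    exists r; split=> // [q /andP[q0 _]|]; first exact: allG.
    apply: le_lt_trans (smooth_supergradient Gx (allG _ r0)) _.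
    rewrite addrAC subrr add0r grad_pairZ /r divfK ?lt_eqF//; lra.
  move=> /existsNP[s0 /not_implyP[s0_ge0 nG]].
  have [s bds reach] := exit_point Gx s0_ge0 nG.
  have : (limf_esup (fun y => (f y)%:E) (within G (nbhs (x + s *: h)%R))
      < sigma%:E)%E.
    by apply: le_lt_trans bd; apply: ereal_sup_ubound; exists (x + s *: h).
  move=> /ereal_inf_lt[_ [V nV <-] supV].
  have [r [r0 Vr rG]] := reach _ nV.
  exists r; split=> //; rewrite -lte_fin; apply: le_lt_trans supV.
  apply: ereal_sup_ubound; exists (x + r *: h) => //; apply: Vr.
  by apply: rG; rewrite r0 lexx.
have cont : {within `[0, r], continuous (fun s : R => f (x + s *: h))}.
  apply: continuous_in_subspaceT => q; rewrite inE/= in_itv/= => /rG Gq.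
  apply: (@continuous_comp _ _ _ (fun s : R => x + s *: h) f).
    exact: continuous_line.
  exact: smooth_continuous.
have [|s sr fs] := IVT r0 cont (v := sigma).
  by rewrite scale0r addr0 ge_min le_max !(ltW sx, ltW fr) orbT.
move: sr; rewrite in_itv/= => sr.
exists s; last by split=> //; exact: rG.
move: sr => /andP[]; rewrite le_eqVlt => /orP[/eqP s0|//].
by move: fs sx; rewrite -s0 scale0r addr0 => ->; rewrite ltxx.
Qed.

End Supergradient.

(** * The cone constant *)

Lemma cone_not0 (R : realType) n (G : set 'rV[R]_n) :
  open G -> is_cone G -> G `<` setT -> ~ G 0.
Proof.
move=> oG cG [_ GT] G0; apply: GT => v _.
have /nbhs_ballP[d /= d0 dG] := @near_line _ _ _ _ v oG G0.
have d2 : 0 < d / 2 by rewrite divr_gt0.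
have : ball 0 d (d / 2).
  by rewrite /ball/= sub0r normrN gtr0_norm// ltr_pdivrMr// ltr_pMr// ltr1n.
move=> /dG /=; rewrite add0r => /(cG (d / 2)^-1).
by rewrite scalerA mulVf ?gt_eqF// scale1r invr_gt0; exact.
Qed.

Lemma col_perm_tperm_ones (R : realType) n (a : R) (i j : 'I_n.+1) :
  col_perm (tperm i ord_max) (ones_but_last a) 0 j = if j == i then a else 1.
Proof.
by rewrite !mxE -(inj_eq (@perm_inj _ (tperm i ord_max))) tpermK tpermR.
Qed.

Section ConeConstant.
Context {R : realType} {n : nat}.
Context (G : set 'rV[R]_n.+1) (f : 'rV[R]_n.+1 -> R).

Lemma positive_cone_open : open (@positive_cone R n.+1).
Proof.
rewrite openE => x x_gt0.
apply: (@filter_forall _ _ (fun i (y : 'rV[R]_n.+1) => 0 < y 0 i) _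
  (nbhs_filter x)) => i.
have : nbhs (x 0 i) [set r : R | 0 < r].
  by apply: open_nbhs_nbhs; split; [exact: open_gt|exact: x_gt0].
exact: (@coord_continuous R 1 n.+1 0 i x).
Qed.

Lemma closure_grad_ge0 x s m (C : set 'rV[R]_n.+1) :
  (forall c, C c -> 0 <= grad_pair f x (col_perm s c)) ->
  closure C m -> 0 <= grad_pair f x (col_perm s m).
Proof.
move=> posC.
pose D : set 'rV[R]_n.+1 :=
  (fun c => grad_pair f x (col_perm s c)) @^-1` [set r | 0 <= r].
suff cD : closed D.
  by move=> /(closure_subset posC); rewrite -(closure_id D).1.
apply: preimage_closed; last exact: closed_ge.
move=> c _; move: c.
have -> : (fun c => grad_pair f x (col_perm s c)) =
    (fun c : 'rV[R]_n.+1 => \sum_i partial i f x * c 0 (s i)).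
  by apply/funext => d; apply: eq_bigr => i _; rewrite mxE.
apply: continuous_big => [|i _ c].
  by move=> z; apply: cvgD; [exact: cvg_fst|exact: cvg_snd].
apply: cvgMl_tmp; first exact: (nbhs_filter c).
exact: (@coord_continuous R 1 n.+1 0 (s i) c).
Qed.

Lemma cone_of_col_perm s m :
  symmetric_set G -> symmetric_fun G f -> is_cone G ->
  cone_of G f m -> cone_of G f (col_perm s m).
Proof.
move=> Gs fs cG [Gm [l fl l_gt]]; split; first exact: Gs.
exists l => //; apply: cvg_trans fl; apply: near_eq_cvg.
near=> t.
have t0 : 0 < t by near: t; apply: nbhs_pinfty_gt; rewrite num_real.
rewrite -(fs s (t *: m)); last exact: cG.
by congr (f _)%:E; apply/rowP => j; rewrite !mxE.
Unshelve. all: by end_near. Qed.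

(** Start at [(1, ..., 1)], which lies in the positive cone, and decrease the
    last entry. When it reaches [- n] the vector is outside [G], because the mean
    of its transposed copies is the origin; so the boundary is crossed. At every
    crossing, whichever one the constant selects, [r > 0], since otherwise all
    entries would be positive and the point interior. *)
Lemma cone_constantP : open G -> convex_set G -> is_cone G ->
  symmetric_set G -> G `<` setT ->
  positive_cone `<=` cone_of G f ->
  0 < cone_constant (cone_of G f) /\
  boundary (cone_of G f) (ones_but_last (1 - cone_constant (cone_of G f))).
Proof.
move=> oG cxG cG sG GT posC.
have nG : ~ G (ones_but_last (1 - n.+1%:R)).
  move=> Gp; apply: (cone_not0 oG cG GT).
  have := convex_set_mean cxG (fun i : 'I_n.+1 => sG (tperm i ord_max) _ Gp).
  congr (G _); apply/rowP => j; rewrite !mxE summxE.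
  under eq_bigr => i _ do rewrite col_perm_tperm_ones.
  rewrite (bigD1 j)//= eqxx (eq_bigr (fun=> 1)); last first.
    by move=> i /negbTE ij; rewrite eq_sym ij.
  rewrite sumr_const cardC1 card_ord -natr1; ring.
have line (s : R) : const_mx 1 + s *: - delta_mx 0 ord_max =
    ones_but_last (1 - s) :> 'rV_n.+1.
  apply/rowP => j; rewrite !mxE eqxx/=.
  by case: eqP => _; rewrite ?mulrN1 // oppr0 mulr0 addr0.
have C1 : cone_of G f (const_mx 1) by apply: posC => i; rewrite mxE.
have [||r br _] := exit_point (h := - delta_mx 0 ord_max) (s0 := n.+1%:R) C1.
- by [].
- by rewrite line => -[].
have bC : boundary (cone_of G f)
    (ones_but_last (1 - cone_constant (cone_of G f))).
  apply: (@getPex _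
    [set r : R | boundary (cone_of G f) (ones_but_last (1 - r))]).
  by exists r; rewrite /= -line.
split=> //; rewrite ltNge; apply/negP => r_le0; case: bC => _; apply.
apply: filterS posC _; apply: open_nbhs_nbhs.
split; first exact: positive_cone_open.
by move=> i; rewrite mxE; case: ifP => _ //; lra.
Qed.

End ConeConstant.

(** * The two gradient inequalities *)

Theorem theorem5p8 (R : realType) (n : nat) (G : set 'rV[R]_n.+1)
    (f : 'rV[R]_n.+1 -> R)
    (G_open : open G) (G_convex : convex_set G) (G_cone : is_cone G)
    (G_sym : symmetric_set G) (G_proper : G `<` setT)
    (G_boundary : boundary G !=set0) (G_pos : positive_cone `<=` G)
    (f_smooth : smooth_on G f) (f_sym : symmetric_fun G f)
    (f_concave : concave_on G f)
    (f_ray : forall x, positive_cone x -> ray_limit_gt_ninfty f x)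
    (f_sum : forall x, G x -> 0 < \sum_i partial i f x) :
  (forall x (i : 'I_n.+1), G x ->
     partial i f x
       <= 1 / cone_constant (cone_of G f) * \sum_j partial j f x)
  /\
  (forall sigma K0 : R,
     (sup_boundary G f < sigma%:E)%E -> (sigma%:E < sup_on G f)%E ->
     (forall x, level G f sigma x ->
        \sum_i partial i f x * x 0 i >= - K0 * \sum_i partial i f x) ->
     forall x, closed_superlevel G f sigma x ->
        \sum_i partial i f x * x 0 i >= - K0 * \sum_i partial i f x).
Proof.
split.
  move=> x i Gx.
  have posC : positive_cone `<=` cone_of G f.
    by move=> y y_gt0; split; [exact: G_pos|exact: f_ray].
  have [r_gt0 [clr _]] :=
    cone_constantP G_open G_convex G_cone G_sym G_proper posC.
  set r := cone_constant _ in r_gt0 clr *.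
  rewrite div1r ler_pdivlMl// -subr_ge0.
  have := closure_grad_ge0 (f := f) (x := x) (s := tperm i ord_max) _ clr.
  have -> : grad_pair f x (col_perm (tperm i ord_max) (ones_but_last (1 - r))) =
      \sum_j partial j f x - r * partial i f x.
    rewrite /grad_pair (bigD1 i)//= col_perm_tperm_ones eqxx.
    rewrite [in RHS](bigD1 i)//=.
    rewrite (eq_bigr (fun j => partial j f x)); first ring.
    by move=> j /negbTE ji; rewrite col_perm_tperm_ones ji mulr1.
  apply=> c Cc.
  apply: (ray_limit_grad_ge0 G_open G_convex f_smooth f_concave) => //.
  exact: cone_of_col_perm.
move=> sigma K0 bd _ Hlevel x [[Gx fx]|Lx]; last exact: Hlevel.
have shift y : (- K0 * \sum_i partial i f y <= \sum_i partial i f y * y 0 i) =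
    (0 <= grad_pair f y (y + const_mx K0)).
  rewrite grad_pairD grad_pair_const -/(grad_pair f y y).
  by rewrite -lerBlDr sub0r mulNr.
rewrite shift leNgt; apply/negP => D_lt0.
set h := x + const_mx K0 in D_lt0.
have [s s0 Ls] :=
  descending_ray_meets_level G_open G_convex f_smooth f_concave bd Gx fx D_lt0.
have [Gz fz] := Ls; have := Hlevel _ Ls; rewrite shift.
have -> : x + s *: h + const_mx K0 = (1 + s) *: h.
  by rewrite scalerDl scale1r /h addrAC.
rewrite grad_pairZ pmulr_rge0 ?addr_gt0// leNgt => /negP; apply.
have := smooth_supergradient G_open G_convex f_smooth f_concave Gz Gx.
rewrite opprD addrA subrr sub0r -scaleNr grad_pairZ fz => H.
rewrite ltNge; apply/negP => /(mulr_ge0 (ltW s0)); lra.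
Qed.
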